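(* Let $J,R,Q\in\mathbb{C}^{n,n}$ with $J^*=-J$, $R^*=R\succeq 0$ and $Q^*=Q\succ 0$, and let $w\in\mathbb{R}$ be such that $(J-R)Q-iwI_n$ is invertible. Let $B\in\mathbb{C}^{n,r}$ be of full column rank and define $\Omega=\operatorname{null}\left((I_n-BB^\dagger)(iwI_n-(J-R)Q)\right)$. Suppose that $\Omega\neq\{0\}$. Then $$\eta_{\mathbb{C}}^{S_d}(J,R;B,iw)^2\geq\inf_{x\in\Omega,\ B^*Qx\neq 0}\left\{\frac{2\|B^\dagger(iwI_n-(J-R)Q)x\|^2}{\|B^*Qx\|^2}-\frac{|x^*Q(iwI_n-(J-R)Q)x|^2}{\|B^*Qx\|^4}\right\}.\qquad(\star)$$ Moreover, let the infimum on the right-hand side of $(\star)$ be attained at $\hat x\in\Omega$ and define $$\hat\Delta_R=-\hat x^*QRQ\hat x\,\frac{(B^*Q\hat x)(B^*Q\hat x)^*}{\|B^*Q\hat x\|^4}.$$ If $R+B\hat\Delta_RB^*\succeq 0$, then equality holds in $(\star)$. In this case, we have $$\sqrt2\,\sigma_{\min}\left(B^\dagger(iwI_n-(J-R)Q)UW^{-*}\right)\geq\eta_{\mathbb{C}}^{S_d}(J,R;B,iw)\geq\sigma_{\min}\left(B^\dagger(iwI_n-(J-R)Q)UW^{-*}\right),$$ where the columns of $U$ form an orthonormal basis of $\Omega$ and $W$ is the Cholesky factor of $U^*QBB^*QU$ (this matrix being positive definite), i.e. $U^*QBB^*QU=WW^*$.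
   Context: $A\succeq 0$ (resp. $\succ 0$, $\preceq 0$) means Hermitian positive semidefinite (resp. positive definite, negative semidefinite). $B^\dagger$ is the Moore-Penrose pseudoinverse, $\|\cdot\|$ is the Euclidean norm of a vector, $\|\cdot\|_F$ the Frobenius norm, $\sigma_{\min}$ the smallest singular value, and $W^{-*}=(W^* )^{-1}$. Define $$S_d^{\mathbb{C}}(J,R;B)=\{(\Delta_J,\Delta_R)\in(\mathbb{C}^{r,r})^2:\Delta_J^*=-\Delta_J,\ \Delta_R\preceq 0,\ R+B\Delta_RB^*\succeq 0\}.$$ For $\lambda\in\mathbb{C}$, the structured eigenvalue backward error is $$\eta_{\mathbb{C}}^{S_d}(J,R;B,\lambda)=\inf\Big\{\sqrt{\|\Delta_J\|_F^2+\|\Delta_R\|_F^2}:(\Delta_J,\Delta_R)\in S_d^{\mathbb{C}}(J,R;B),\ \det\left((J-R)Q+B(\Delta_J-\Delta_R)B^*Q-\lambda I_n\right)=0\Big\}.$$ The infimum of the empty set is $+\infty$.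
   Formalization: Positive definiteness of U^*QBB^*QU is assumed for the final singular-value bounds rather than asserted, since it can fail under the stated hypotheses (the matrix may be singular, and then W^{-*} does not exist). *)

(* Defs.v *)
From HB Require Import structures.
From mathcomp Require Import all_boot all_order all_algebra.
From mathcomp Require Import all_classical all_reals.
From mathcomp Require Import ereal spectral sesquilinear complex.
Set Implicit Arguments.
Unset Strict Implicit.
Unset Printing Implicit Defensive.
Import Order.TTheory GRing.Theory Num.Theory.
Local Open Scope ring_scope.
Local Open Scope classical_set_scope.
Local Open Scope complex_scope.
Local Open Scope sesquilinear_scope.

(* The complex numbers are K[i] for K : realType, and A ^t* is the conjugate
   transpose of A.  The order on K[i] is the partial one: 0 <= z means that z is
   real and nonnegative, and z <= 0 that z is real and nonpositive. *)

Notation normc := ComplexField.Normc.normc.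

Section MatrixNotions.
Variable K : realType.
Implicit Types m n r k : nat.

Definition psdmx n (A : 'M[K[i]]_n) : Prop :=
  A ^t* = A /\ forall x : 'cV[K[i]]_n, 0 <= (x ^t* *m A *m x) 0 0.

Definition pdmx n (A : 'M[K[i]]_n) : Prop :=
  A ^t* = A /\ forall x : 'cV[K[i]]_n, x != 0 -> 0 < (x ^t* *m A *m x) 0 0.

Definition nsdmx n (A : 'M[K[i]]_n) : Prop :=
  A ^t* = A /\ forall x : 'cV[K[i]]_n, (x ^t* *m A *m x) 0 0 <= 0.

Definition l2norm n (x : 'cV[K[i]]_n) : K :=
  Num.sqrt (\sum_i normc (x i 0) ^+ 2).

Definition fnorm m n (A : 'M[K[i]]_(m, n)) : K :=
  Num.sqrt (\sum_i \sum_j normc (A i j) ^+ 2).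

Definition nullspace m n (A : 'M[K[i]]_(m, n)) : set 'cV[K[i]]_n :=
  [set x | A *m x = 0].

Definition is_mppinv m n (B : 'M[K[i]]_(m, n)) (X : 'M[K[i]]_(n, m)) : Prop :=
  [/\ B *m X *m B = B, X *m B *m X = X,
      (B *m X) ^t* = B *m X & (X *m B) ^t* = X *m B].

(* By is_mppinv_unique and mppinvP below, mppinv B is the only matrix
   satisfying the four Penrose equations, and the default value 0 is never
   used. *)
Definition mppinv m n (B : 'M[K[i]]_(m, n)) : 'M[K[i]]_(n, m) :=
  xget 0 [set X | is_mppinv B X].

(* An m x n matrix has minn m n singular values, so they are read off the
   smaller of the two Gram matrices: the larger one may have spurious zero
   eigenvalues. *)
Definition singular_value m n (A : 'M[K[i]]_(m, n)) (s : K) : Prop :=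
  0 <= s /\ if (n <= m)%N then eigenvalue (A ^t* *m A) (s ^+ 2)%:C
            else eigenvalue (A *m A ^t*) (s ^+ 2)%:C.

Definition sigma_min m n (A : 'M[K[i]]_(m, n)) : K :=
  inf [set s | singular_value A s].

Definition is_cholesky n (A W : 'M[K[i]]_n) : Prop :=
  [/\ is_trig_mx W, forall i, 0 < W i i & A = W *m W ^t*].

Definition orthonormal_basis n k (U : 'M[K[i]]_(n, k))
    (V : set 'cV[K[i]]_n) : Prop :=
  U ^t* *m U = 1%:M /\ forall x, V x <-> exists y : 'cV[K[i]]_k, x = U *m y.

End MatrixNotions.

Section BackwardError.
Variable K : realType.
Variables n r : nat.
Implicit Types (J R Q : 'M[K[i]]_n) (B : 'M[K[i]]_(n, r)).

(* S_d(J, R; B) does not depend on J. *)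
Definition Sd R B : set ('M[K[i]]_r * 'M[K[i]]_r) :=
  [set D | [/\ D.1 ^t* = - D.1, nsdmx D.2 & psdmx (R + B *m D.2 *m B ^t*)]].

Definition eta_Sd J R Q B (lambda : K[i]) : \bar K :=
  ereal_inf [set (Num.sqrt (fnorm D.1 ^+ 2 + fnorm D.2 ^+ 2))%:E | D in
    [set D | Sd R B D /\
      \det ((J - R) *m Q + B *m (D.1 - D.2) *m B ^t* *m Q - lambda%:M) = 0]].

(* i w I_n - (J - R) Q; the complex number w *i is 0 +i* w. *)
Definition shifted J R Q (w : K) : 'M[K[i]]_n := (w *i)%:M - (J - R) *m Q.

Definition Omega J R Q B w : set 'cV[K[i]]_n :=
  nullspace ((1%:M - B *m mppinv B) *m shifted J R Q w).

Definition objective J R Q B w (x : 'cV[K[i]]_n) : K :=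
  2 * l2norm (mppinv B *m shifted J R Q w *m x) ^+ 2
    / l2norm (B ^t* *m Q *m x) ^+ 2
  - normc ((x ^t* *m Q *m shifted J R Q w *m x) 0 0) ^+ 2
    / l2norm (B ^t* *m Q *m x) ^+ 4.

Definition feasible J R Q B w : set 'cV[K[i]]_n :=
  [set x | Omega J R Q B w x /\ B ^t* *m Q *m x != 0].

Definition inf_objective J R Q B w : \bar K :=
  ereal_inf [set (objective J R Q B w x)%:E | x in feasible J R Q B w].

Definition DeltaR_hat R Q B (x : 'cV[K[i]]_n) : 'M[K[i]]_r :=
  let u := B ^t* *m Q *m x in
  - ((x ^t* *m Q *m R *m Q *m x) 0 0 / (l2norm u ^+ 4)%:C) *: (u *m u ^t*).

End BackwardError.

Section MoorePenrose.
Variable K : realType.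
Implicit Types m n k : nat.

Lemma adjmxM m n k (A : 'M[K[i]]_(m, n)) (B : 'M[K[i]]_(n, k)) :
  (A *m B) ^t* = B ^t* *m A ^t*.
Proof. by rewrite trmx_mul map_mxM. Qed.

Lemma is_mppinv_unique m n (B : 'M[K[i]]_(m, n)) X Y :
  is_mppinv B X -> is_mppinv B Y -> X = Y.
Proof.
move=> [bx1 bx2 bx3 bx4] [by1 by2 by3 by4].
have BXY : B *m X = B *m Y.
  rewrite -bx3 -{1}by1 -[_ *m X]mulmxA adjmxM bx3 by3 mulmxA.
  by rewrite bx1.
have XBY : X *m B = Y *m B.
  rewrite -bx4 -{1}by1 -[B *m Y *m B]mulmxA mulmxA adjmxM bx4 by4 -mulmxA.
  by rewrite [B *m (X *m B)]mulmxA bx1.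
by rewrite -bx2 XBY -mulmxA BXY mulmxA by2.
Qed.

Lemma gram_unit k n (F : 'M[K[i]]_(k, n)) :
  row_free F -> F *m F ^t* \in unitmx.
Proof.
move=> freeF; rewrite -row_free_unit -kermx_eq0; apply/eqP/row_matrixP => i.
rewrite row0; set v := row i _.
have vFF : v *m (F *m F ^t*) = 0 by apply/sub_kermxP; exact: row_sub.
have vF0 : v *m F = 0.
  apply/eqP; rewrite -(dnorm_eq0 (@dotmx K[i] n)); apply/eqP.
  transitivity ((v *m F *m (v *m F) ^t*) 0 0); first exact: dotmxE.
  by rewrite adjmxM mulmxA -[v *m F *m _]mulmxA vFF mul0mx mxE.
by apply/eqP; move: (congr1 (mulmxr (pinvmx F)) vF0) => /=;
  rewrite mul0mx mulmxKp// => ->.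
Qed.

Lemma is_mppinv_factor m p n (C : 'M[K[i]]_(m, p)) (F : 'M[K[i]]_(p, n)) :
  row_full C -> row_free F ->
  is_mppinv (C *m F)
    (F ^t* *m invmx (F *m F ^t*) *m (invmx (C ^t* *m C) *m C ^t*)).
Proof.
move=> fullC freeF; have uF := gram_unit freeF.
have uC : C ^t* *m C \in unitmx.
  rewrite -{2}[C]trmxCK; apply: gram_unit.
  by rewrite /row_free mxrank_map mxrank_tr.
have invJ k (A : 'M[K[i]]_k) : A ^t* = A -> (invmx A) ^t* = invmx A.
  by move=> AE; rewrite trmx_inv map_invmx AE.
set X := _ *m (_ *m _).
have BX : C *m F *m X = C *m invmx (C ^t* *m C) *m C ^t*.
  by rewrite /X -!mulmxA (mulmxA F (F ^t*)) mulKVmx.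
have XB : X *m (C *m F) = F ^t* *m invmx (F *m F ^t*) *m F.
  by rewrite /X -!mulmxA (mulmxA (C ^t*) C) mulKmx.
split.
- by rewrite BX -!mulmxA (mulmxA (C ^t*) C) mulKmx.
- by rewrite XB /X -!mulmxA (mulmxA F (F ^t*)) mulKVmx.
- by rewrite BX !adjmxM trmxCK invJ ?mulmxA// adjmxM trmxCK.
- by rewrite XB !adjmxM trmxCK invJ ?mulmxA// adjmxM trmxCK.
Qed.

Lemma mppinvP m n (B : 'M[K[i]]_(m, n)) : is_mppinv B (mppinv B).
Proof.
suff [X BX] : exists X, is_mppinv B X by exact: (xgetPex 0 (ex_intro _ X BX)).
have := is_mppinv_factor (col_base_full B) (row_base_free B).
by rewrite mulmx_base => BX; eexists; exact: BX.
Qed.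

End MoorePenrose.

(* Main.v *)
Require Import Defs.
From HB Require Import structures.
From mathcomp Require Import all_boot all_order all_algebra.
From mathcomp Require Import all_classical all_reals.
From mathcomp Require Import ereal spectral sesquilinear complex.
From mathcomp Require Import ring.
Set Implicit Arguments.
Unset Strict Implicit.
Unset Printing Implicit Defensive.
Import Order.TTheory GRing.Theory Num.Theory.
Local Open Scope ring_scope.
Local Open Scope sesquilinear_scope.

(** Write M = i w I - (J - R) Q, G = B^* Q and E = Delta_J - Delta_R.
    For an admissible perturbation M - B E G is singular; for a kernel vector x,
    u = G x and v = E u this says M x = B v, so that x lies in Omega and
    v = B^+ M x.  Moreover u^* v = x^* Q M x, so the objective at x only depends
    on the pair (u, v); it is [cost u v] below.  Skew-Hermitian and Hermitian
    matrices are orthogonal, hence |Delta_J|^2 + |Delta_R|^2 = |E|^2.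

    Lower bound.  The inequality |E|^2 >= cost u v may fail for the kernel vector
    x itself, and another element of Omega may be needed.  Dissipativity enters
    once: Q (M - B E G) is the sum of a skew-Hermitian matrix and of
    Q (R + B Delta_R B^* ) Q, which is positive semidefinite, so its right kernel
    vector x is also a left kernel vector ([left_kernel]).  Normalise |u| = 1, let
    s = u^* E u and c = s / 2.  Looking only at the row and the column of E in the
    direction u gives
      |E|^2 >= |E u - c u|^2 + |E^* u - c^* u|^2 + 2 |c|^2,
    whereas cost u v <= 2 |v - c u|^2 / |u|^2 + 2 |c|^2 for every u, v and c.  If
    the first square is the smaller one, x does the job.  Otherwise the left
    kernel equation is an equation for the adjoint of G (M - c B G)^-1 B, and as a
    matrix and its adjoint have the same norm, (M - c B G)^-1 B u yields a vector
    of Omega for which |v - c u|^2 / |u|^2 is at most the second square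
    ([cost_le_frob2]).

    Equality.  For a feasible x the matrix
      E = (v u^* - u v^* ) / |u|^2 + (v^* u) u u^* / |u|^4
    maps u to v and has squared norm cost u v, and minus its Hermitian part is the
    matrix hat Delta_R ([attaining_perturbation]).  So as soon as hat Delta_R is
    admissible the minimum of the objective is reached.

    Singular values.  By Cauchy-Schwarz cost u v lies between |v|^2 / |u|^2 and
    twice that number.  In the coordinates x = U W^{-*} z one has |u| = |z| and
    v = Z z with Z = B^+ M U W^{-*}, so the infimum of |v|^2 / |u|^2 is the square
    of the smallest singular value of Z. *)

(** * Adjoints and squared Frobenius norms *)

Section Adjoint.
Variable C : numClosedFieldType.
Implicit Types m n p : nat.

Lemma adjM m n p (A : 'M[C]_(m, n)) (B : 'M[C]_(n, p)) :
  (A *m B) ^t* = B ^t* *m A ^t*.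
Proof. by rewrite trmx_mul map_mxM. Qed.

Lemma adjD m n (A B : 'M[C]_(m, n)) : (A + B) ^t* = A ^t* + B ^t*.
Proof. by rewrite linearD map_mxD. Qed.

Lemma adjN m n (A : 'M[C]_(m, n)) : (- A) ^t* = - A ^t*.
Proof. by rewrite linearN map_mxN. Qed.

Lemma adjB m n (A B : 'M[C]_(m, n)) : (A - B) ^t* = A ^t* - B ^t*.
Proof. by rewrite adjD adjN. Qed.

Lemma adjZ m n a (A : 'M[C]_(m, n)) : (a *: A) ^t* = a^* *: A ^t*.
Proof. by rewrite linearZ map_mxZ. Qed.

Lemma adj_scalar n (a : C) : (a%:M : 'M[C]_n) ^t* = (a^*)%:M.
Proof. by rewrite tr_scalar_mx map_scalar_mx. Qed.

(** The squared norm is kept in the field C itself, where it is a polynomial in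
    the entries and their conjugates and can be rearranged by ring identities. *)
Definition frob2 m n (A : 'M[C]_(m, n)) : C := \tr (A *m A ^t*).

Lemma frob2E m n (A : 'M[C]_(m, n)) :
  frob2 A = \sum_i \sum_j `|A i j| ^+ 2.
Proof.
apply: eq_bigr => i _; rewrite mxE; apply: eq_bigr => j _.
by rewrite !mxE normCK.
Qed.

Lemma frob2_ge0 m n (A : 'M[C]_(m, n)) : 0 <= frob2 A.
Proof.
by rewrite frob2E; do 2![apply: sumr_ge0 => ? _]; rewrite exprn_ge0.
Qed.

Lemma frob2_eq0 m n (A : 'M[C]_(m, n)) : (frob2 A == 0) = (A == 0).
Proof.
apply/eqP/eqP => [|->]; last by rewrite /frob2 mul0mx mxtrace0.
rewrite frob2E => /psumr_eq0P A0; apply/matrixP => i j; rewrite mxE.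
have /psumr_eq0P /(_ j isT)/eqP : \sum_j `|A i j| ^+ 2 = 0.
  by apply: A0 => // ? _; apply: sumr_ge0 => ? _; rewrite exprn_ge0.
rewrite expf_eq0 normr_eq0 => Aij; apply/eqP; apply: Aij => ? _.
by rewrite exprn_ge0.
Qed.

Lemma frob2_0 m n : frob2 (0 : 'M[C]_(m, n)) = 0.
Proof. by apply/eqP; rewrite frob2_eq0. Qed.

Lemma frob2_gt0 m n (A : 'M[C]_(m, n)) : (0 < frob2 A) = (A != 0).
Proof. by rewrite lt_def frob2_ge0 andbT frob2_eq0. Qed.

Lemma frob2_adj m n (A : 'M[C]_(m, n)) : frob2 (A ^t*) = frob2 A.
Proof. by rewrite /frob2 trmxCK mxtrace_mulC. Qed.

Lemma frob2Z m n a (A : 'M[C]_(m, n)) : frob2 (a *: A) = `|a| ^+ 2 * frob2 A.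
Proof.
by rewrite /frob2 adjZ -scalemxAl -scalemxAr scalerA mxtraceZ normCK.
Qed.

Lemma frob2_scalar1 (a : C) : frob2 (a%:M : 'M_1) = `|a| ^+ 2.
Proof. by rewrite frob2E !big_ord1 mxE eqxx. Qed.

Lemma mulmx_adjl n (x : 'cV[C]_n) : x ^t* *m x = (frob2 x)%:M.
Proof. by rewrite [LHS]mx11_scalar /frob2 mxtrace_mulC trace_mx11. Qed.

(** In an orthonormal basis starting with u, the matrix E consists of its first
    column E u and of the remaining columns, which form E (1 - u u^* ). *)
Lemma frob2_pythagoras m n (E : 'M[C]_(m, n)) (u : 'cV[C]_n) :
  frob2 u = 1 ->
  frob2 E = frob2 (E *m u) + frob2 (E *m (1%:M - u *m u ^t*)).
Proof.
move=> u1; set P := 1%:M - _.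
have PJ : P ^t* = P by rewrite adjB adjM trmxCK adj_scalar rmorph1.
have PP : P *m P = P.
  rewrite {2}/P mulmxBr mulmx1 /P mulmxBl mul1mx mulmxA -[_ *m _ *m u]mulmxA.
  by rewrite mulmx_adjl u1 mulmx1 subrr subr0.
rewrite /frob2 !adjM PJ !mulmxA -(mulmxA E P) PP mulmxBr mulmx1 mulmxBl.
by rewrite linearB /= !mulmxA addrC subrK.
Qed.

(** In an orthonormal basis starting with u, only the first row and the first
    column of E are counted; their common entry u^* E u is subtracted once. *)
Lemma frob2_ge_row_col n (E : 'M[C]_n) (u : 'cV[C]_n) :
  frob2 u = 1 ->
  frob2 (E *m u) + frob2 (u ^t* *m E) - frob2 (u ^t* *m E *m u) <= frob2 E.
Proof.
move=> u1; rewrite (frob2_pythagoras E u1) (frob2_pythagoras (u ^t* *m E) u1).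
set P := 1%:M - _; rewrite -addrA lerD2l [X in X <= _]addrC addKr.
rewrite -[frob2 (E *m P)]frob2_adj (frob2_pythagoras ((E *m P) ^t*) u1).
by rewrite -[frob2 (u ^t* *m E *m P)]frob2_adj -mulmxA (adjM (u ^t*)) trmxCK lerDl frob2_ge0.
Qed.

(** The cross terms are the trace of S H and its opposite. *)
Lemma frob2_split n (S H : 'M[C]_n) :
  S ^t* = - S -> H ^t* = H -> frob2 (S - H) = frob2 S + frob2 H.
Proof.
move=> sS hH; rewrite /frob2 adjB sS hH mulmxBl !mulmxBr !mulmxN !linearB /=.
by rewrite !linearN /= (mxtrace_mulC H S); ring.
Qed.

Lemma frob2_normalize n (u : 'cV[C]_n) :
  u != 0 -> frob2 ((sqrtC (frob2 u))^-1 *: u) = 1.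
Proof.
rewrite -frob2_eq0 => u0.
by rewrite frob2Z normfV exprVn -normrX sqrtCK ger0_norm ?frob2_ge0// mulVf.
Qed.

(** Normalising u, this is the first column alone in [frob2_pythagoras].  For a
    row E it is the Cauchy-Schwarz inequality. *)
Lemma frob2_mulmx_le m n (E : 'M[C]_(m, n)) (u : 'cV[C]_n) :
  frob2 (E *m u) <= frob2 E * frob2 u.
Proof.
have [->|u0] := eqVneq u 0.
  by rewrite mulmx0 !frob2_0 mulr0.
have := frob2_pythagoras E (frob2_normalize u0).
rewrite -scalemxAr frob2Z normfV exprVn -normrX sqrtCK ger0_norm ?frob2_ge0//.
move=> EP; rewrite -ler_pdivrMr ?frob2_gt0// EP mulrC lerDl.
exact: frob2_ge0.
Qed.

(** If y = A x were nonzero, then at a x - y the form would take the value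
    y^* A y - 2 a |y|^2, which is negative for large real a. *)
Lemma psd_kernel n (A : 'M[C]_n) (x : 'cV[C]_n) :
    A ^t* = A -> (forall y : 'cV[C]_n, 0 <= (y ^t* *m A *m y) 0 0) ->
  x ^t* *m A *m x = 0 -> A *m x = 0.
Proof.
move=> hA psdA xAx; apply/eqP; rewrite -frob2_eq0; apply/negP => /negP Ax0.
(* With this a, a |y|^2 = y^* A y + 1, and the form is - (y^* A y) - 2. *)
set y := A *m x; set b := (y ^t* *m A *m y) 0 0; set a := (b + 1) / frob2 y.
have ra : a^* = a.
  apply/CrealP/ger0_real; rewrite divr_ge0 ?frob2_ge0 // addr_ge0 //.
  exact: psdA.
have := psdA (a *: x - y).
rewrite adjB adjZ ra !mulmxBl !mulmxBr -!scalemxAl -!scalemxAr xAx !scaler0.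
have -> : x ^t* *m A = y ^t* by rewrite /y adjM hA.
have yAy : y ^t* *m A *m y = b%:M by exact: mx11_scalar.
rewrite -!(mulmxA _ A x) -/y yAy mulmx_adjl !mxE /= !mulr1n.
rewrite /a divfK // => h.
suff : b + 1 + 1 <= 0.
  by apply/negP; rewrite lt_geF // ltr_wpDl // addr_ge0 //; exact: psdA.
by move: h; rewrite -oppr_ge0; congr (0 <= _); ring.
Qed.

End Adjoint.

(** * The lower bound at a left and right kernel vector *)

Section KernelVectors.
Variable C : numClosedFieldType.
Implicit Types n r : nat.

(** The real part of x^* (T + Q S Q) x is x^* Q S Q x; it vanishes, so S Q x = 0
    since S is positive semidefinite, and then T x = 0.  Both summands are
    Hermitian or skew-Hermitian, hence also vanish on the left. *)
Lemma left_kernel n (S T Q : 'M[C]_n) (x : 'cV[C]_n) :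
    S ^t* = S -> (forall y : 'cV[C]_n, 0 <= (y ^t* *m S *m y) 0 0) ->
    T ^t* = - T -> Q ^t* = Q ->
  (T + Q *m S *m Q) *m x = 0 -> x ^t* *m (T + Q *m S *m Q) = 0.
Proof.
move=> hS psdS hT hQ Nx.
have h : x ^t* *m T *m x + x ^t* *m (Q *m S *m Q) *m x = 0.
  by rewrite -mulmxDl -mulmxDr -mulmxA Nx mulmx0.
have hQSQ : (Q *m S *m Q) ^t* = Q *m S *m Q by rewrite !adjM hQ hS mulmxA.
have h' : - (x ^t* *m T *m x) + x ^t* *m (Q *m S *m Q) *m x = 0.
  have := congr1 (fun A : 'M[C]_1 => A ^t*) h.
  rewrite adjD !(adjM _ x) !(adjM (x ^t*)) trmxCK hT hQSQ.
  by rewrite mulNmx mulmxN !mulmxA trmx0 map_mx0.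
have /eqP : x ^t* *m (Q *m S *m Q) *m x = 0.
  have := congr2 +%R h h'; rewrite addr0 addrACA subrr add0r => /eqP.
  by rewrite -mulr2n -scaler_nat scaler_eq0 pnatr_eq0 => /eqP.
have -> : x ^t* *m (Q *m S *m Q) *m x = (Q *m x) ^t* *m S *m (Q *m x).
  by rewrite adjM hQ !mulmxA.
move=> /eqP /(psd_kernel hS psdS) SQx.
have QSQx : Q *m S *m Q *m x = 0 by rewrite -!mulmxA SQx mulmx0.
have Tx : T *m x = 0 by move: Nx; rewrite mulmxDl QSQx addr0.
rewrite mulmxDr -[T]opprK -hT -hQSQ mulmxN -!adjM Tx QSQx.
by rewrite linear0 map_mx0 oppr0 addr0.
Qed.

(** The least |E|^2 among the matrices E with E u = v whose Hermitian part is a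
    multiple of u u^*; see [attaining_perturbation]. *)
Definition cost r (u v : 'cV[C]_r) : C :=
  2 * frob2 v / frob2 u - frob2 (u ^t* *m v) / frob2 u ^+ 2.

(** The difference of the two sides is the square of the modulus of
    u^* v / |u|^2 - 2 c.  Minimising over c recovers the cost, so that bounding it
    amounts to choosing a good shift c. *)
Lemma cost_le_shift r (u v : 'cV[C]_r) (c : C) : u != 0 ->
  cost u v <= 2 * (frob2 (v - c *: u) / frob2 u) + 2 * `|c| ^+ 2.
Proof.
rewrite -frob2_eq0 => u0; set s := (u ^t* *m v) 0 0.
have uv : u ^t* *m v = s%:M by exact: mx11_scalar.
have vu : v ^t* *m u = (s^*)%:M by rewrite -adj_scalar -uv adjM trmxCK.
have ru : (frob2 u)^* = frob2 u by apply/CrealP/ger0_real/frob2_ge0.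
rewrite -subr_ge0.
suff -> : 2 * (frob2 (v - c *: u) / frob2 u) + 2 * `|c| ^+ 2 - cost u v
   = `|s / frob2 u - 2 * c| ^+ 2 by rewrite exprn_ge0.
have -> : frob2 (v - c *: u) =
    frob2 v - c^* * s - c * s^* + c * c^* * frob2 u.
  rewrite [LHS]/frob2 adjB adjZ mulmxBl !mulmxBr -!scalemxAl -!scalemxAr.
  rewrite !linearB /= !mxtraceZ (mxtrace_mulC v (u ^t*)) (mxtrace_mulC u) uv vu.
  by rewrite !trace_mx11 !mxE -!/(frob2 _) /= !mulr1n; ring.
rewrite /cost uv frob2_scalar1 !normCK !rmorphB !rmorphM /=.
by rewrite fmorphV /= ru rmorph_nat; field.
Qed.

Lemma cost_ge r (u v : 'cV[C]_r) : u != 0 -> frob2 v / frob2 u <= cost u v.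
Proof.
rewrite -frob2_gt0 => u0; rewrite /cost -subr_ge0.
have -> : 2 * frob2 v / frob2 u - frob2 (u ^t* *m v) / frob2 u ^+ 2
   - frob2 v / frob2 u
  = (frob2 u * frob2 v - frob2 (u ^t* *m v)) / frob2 u ^+ 2.
  by field; rewrite gt_eqF.
rewrite divr_ge0 ?exprn_ge0 ?frob2_ge0// subr_ge0 -[frob2 u]frob2_adj.
exact: frob2_mulmx_le.
Qed.

Lemma cost_le r (u v : 'cV[C]_r) : cost u v <= 2 * (frob2 v / frob2 u).
Proof.
by rewrite /cost mulrA lerBlDr lerDl divr_ge0 ?exprn_ge0 ?frob2_ge0.
Qed.

(** The heart of the lower bound.  The vector y need not be x: when the column of
    E in the direction u = G x is longer than its row, y is built from the left
    kernel vector l. *)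
Lemma cost_le_frob2 n r (M : 'M[C]_n) (B : 'M[C]_(n, r)) (G : 'M[C]_(r, n))
    (E : 'M[C]_r) (x : 'cV[C]_n) (l : 'rV[C]_n) :
    M \in unitmx -> (M - B *m E *m G) *m x = 0 -> l *m (M - B *m E *m G) = 0 ->
    l *m B = (G *m x) ^t* -> frob2 (G *m x) = 1 ->
  exists (y : 'cV[C]_n) (v : 'cV[C]_r),
    [/\ M *m y = B *m v, G *m y != 0 & cost (G *m y) v <= frob2 E].
Proof.
move=> uM Nx lN lB; set u := G *m x => u1.
have Mx : M *m x = B *m (E *m u).
  by apply/eqP; rewrite -subr_eq0 /u !mulmxA -mulmxBl Nx.
have lM : l *m M = u ^t* *m E *m G.
  by apply/eqP; rewrite -subr_eq0 -lB -!mulmxA -mulmxBr !mulmxA lN.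
have u0 : u != 0 by rewrite -frob2_eq0 u1 oner_eq0.
(* This shift gives equality in [cost_le_shift] for v = E u. *)
set s := (u ^t* *m E *m u) 0 0; set c := s / 2.
have us : u ^t* *m E *m u = s%:M by exact: mx11_scalar.
set p := E *m u - c *: u; set q := u ^t* *m E - c *: u ^t*.
have Epq : frob2 p + frob2 q + 2 * `|c| ^+ 2 <= frob2 E.
  apply: le_trans (frob2_ge_row_col E u1); rewrite us frob2_scalar1.
  have uu : u ^t* *m u = 1%:M by rewrite mulmx_adjl u1.
  have ep : frob2 p = frob2 (E *m u) - c^* * s - c * s^* + c * c^*.
    rewrite [LHS]/frob2 adjB adjZ mulmxBl !mulmxBr -!scalemxAl -!scalemxAr.
    rewrite !linearB /= !mxtraceZ (mxtrace_mulC _ (u ^t*)) (mxtrace_mulC u).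
    rewrite (mulmxA (u ^t*) E) us.
    have -> : (E *m u) ^t* *m u = (s^*)%:M.
      by rewrite -adj_scalar -us -mulmxA (adjM (u ^t*)) trmxCK.
    rewrite (mxtrace_mulC u) uu !trace_mx11 !mxE -!/(frob2 _) /= !mulr1n.
    ring.
  have eq : frob2 q = frob2 (u ^t* *m E) - c^* * s - c * s^* + c * c^*.
    rewrite [LHS]/frob2 adjB adjZ trmxCK mulmxBl !mulmxBr.
    rewrite -!scalemxAl -!scalemxAr us.
    have -> : u ^t* *m (u ^t* *m E) ^t* = (s^*)%:M.
      by rewrite -adj_scalar -us (adjM (u ^t* *m E)).
    rewrite uu !linearB /= !mxtraceZ !mxtrace_scalar -!/(frob2 _) !mulr1n.
    ring.
  rewrite ep eq le_eqVlt; apply/orP; left; apply/eqP.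
  by rewrite /c !normCK !fmorph_div rmorph_nat /=; field.
(* The smaller of |p|^2 and |q|^2 may be counted twice. *)
have [pq|/ltW qp] := real_leP (ger0_real (frob2_ge0 p)) (ger0_real (frob2_ge0 q)).
  exists x; exists (E *m u); split=> //.
  apply: le_trans Epq; apply: le_trans (cost_le_shift _ c u0) _.
  by rewrite -/u u1 divr1 lerD2r mulr_natl mulr2n lerD2l.
suff [y [z [Mz Gy0 zq]]] : exists (y : 'cV[C]_n) (z : 'cV[C]_r),
    [/\ M *m y = B *m (z + c *: (G *m y)), G *m y != 0 &
        frob2 z <= frob2 q * frob2 (G *m y)].
  exists y; exists (z + c *: (G *m y)); split=> //.
  apply: le_trans Epq; apply: le_trans (cost_le_shift _ c Gy0) _.
  rewrite addrK lerD2r mulr_natl mulr2n lerD //.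
    by rewrite (le_trans _ qp)// ler_pdivrMr ?frob2_gt0.
  by rewrite ler_pdivrMr ?frob2_gt0.
set Mc := M - c *: (B *m G).
have McE y z : Mc *m y = B *m z -> M *m y = B *m (z + c *: (G *m y)).
  rewrite mulmxBl -scalemxAl => /eqP; rewrite subr_eq => /eqP ->.
  by rewrite mulmxDr -scalemxAr mulmxA.
(* If Mc is singular, a kernel vector of Mc does even better, with z = 0. *)
have [uMc|] := boolP (Mc \in unitmx); last first.
  rewrite -unitmx_tr unitmxE unitfE negbK => /det0P[v v0 vMc].
  exists v^T; exists 0.
  have My : M *m v^T = B *m (0 + c *: (G *m v^T)).
    by apply: McE; rewrite mulmx0; apply: trmx_inj; rewrite trmx_mul trmxK vMc trmx0.
  split=> //; last by rewrite frob2_0 mulr_ge0 ?frob2_ge0.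
  apply: contraNneq v0 => Gv; move: My; rewrite Gv scaler0 addr0 mulmx0.
  by move=> /(congr1 (mulmx (invmx M))); rewrite mulKmx// mulmx0 -trmx0 => /trmx_inj ->.
have lMc : l *m Mc = q *m G.
  by rewrite mulmxBr lM -scalemxAr mulmxA lB mulmxBl -scalemxAl.
(* Since q (G y) = 1, Cauchy-Schwarz gives 1 <= |q|^2 |G y|^2. *)
set y := invmx Mc *m (B *m u).
have qGy : q *m (G *m y) = 1%:M.
  by rewrite mulmxA -lMc -mulmxA mulKVmx// mulmxA lB -/u mulmx_adjl u1.
exists y; exists u; split.
- by apply: McE; rewrite mulKVmx.
- by apply: contra_eq_neq qGy => ->; rewrite mulmx0 eq_sym matrix_nonzero1.
- rewrite u1; apply: le_trans (frob2_mulmx_le _ _); rewrite qGy.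
  by rewrite frob2_scalar1 normr1 expr1n.
Qed.

End KernelVectors.

(** * Structured perturbations and Rayleigh quotients *)

Section Perturbations.
Variable C : numClosedFieldType.
Implicit Types n r : nat.

Lemma det0_cVP n (A : 'M[C]_n) :
  reflect (exists2 x : 'cV[C]_n, x != 0 & A *m x = 0) (\det A == 0).
Proof.
rewrite -det_tr; apply: (iffP det0P) => [[v v0 vA]|[x x0 Ax]].
  exists v^T; first by rewrite -trmx0 (inj_eq trmx_inj).
  by apply: trmx_inj; rewrite trmx_mul trmxK vA trmx0.
exists x^T; first by rewrite -trmx0 (inj_eq trmx_inj).
by rewrite -trmx_mul Ax trmx0.
Qed.

Lemma det_opp_eq0 n (A : 'M[C]_n) : (\det (- A) == 0) = (\det A == 0).
Proof. by rewrite -scaleN1r detZ mulf_eq0 signr_eq0. Qed.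

Lemma adj_rank1 n (c : C) (u : 'cV[C]_n) :
  0 <= c -> (- c *: (u *m u ^t*)) ^t* = - c *: (u *m u ^t*).
Proof.
by move=> c0; rewrite adjZ adjM trmxCK rmorphN /= (CrealP (ger0_real c0)).
Qed.

Lemma rank1_le0 n (c : C) (u x : 'cV[C]_n) :
  0 <= c -> (x ^t* *m (- c *: (u *m u ^t*)) *m x) 0 0 <= 0.
Proof.
move=> c0; rewrite -scalemxAr -scalemxAl mxE mulNr oppr_le0 mulr_ge0 //.
have -> : x ^t* *m (u *m u ^t*) *m x = (u ^t* *m x) ^t* *m (u ^t* *m x).
  by rewrite adjM trmxCK !mulmxA.
by rewrite mulmx_adjl mxE mulr1n frob2_ge0.
Qed.

(** Rescaling a right kernel vector x so that |G x| = 1 and taking x^* Q as left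
    kernel vector reduces the bound to [cost_le_frob2]. *)
Lemma cost_le_perturbation n r (J R Q : 'M[C]_n) (B : 'M[C]_(n, r)) (a : C)
    (D1 D2 : 'M[C]_r) :
    let M := a%:M - (J - R) *m Q in
    let S := R + B *m D2 *m B ^t* in
    a^* = - a -> J ^t* = - J -> Q ^t* = Q -> D1 ^t* = - D1 ->
    S ^t* = S -> (forall y : 'cV[C]_n, 0 <= (y ^t* *m S *m y) 0 0) ->
    M \in unitmx -> \det (M - B *m (D1 - D2) *m (B ^t* *m Q)) = 0 ->
  exists (y : 'cV[C]_n) (v : 'cV[C]_r),
    [/\ M *m y = B *m v, B ^t* *m Q *m y != 0 &
        cost (B ^t* *m Q *m y) v <= frob2 (D1 - D2)].
Proof.
set G := B ^t* *m Q.
move=> M S ha hJ hQ hD1 hS psdS uM /eqP/det0_cVP[x0 x00 Nx0].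
have Gx0 : G *m x0 != 0.
  apply: contra_neq x00 => Gx0; move: Nx0.
  rewrite mulmxBl -(mulmxA _ G) Gx0 mulmx0 subr0 => /(congr1 (mulmx (invmx M))).
  by rewrite mulKmx // mulmx0.
set x := (sqrtC (frob2 (G *m x0)))^-1 *: x0.
have Nx : (M - B *m (D1 - D2) *m G) *m x = 0 by rewrite -scalemxAr Nx0 scaler0.
have Gx1 : frob2 (G *m x) = 1 by rewrite -scalemxAr frob2_normalize.
set T := a *: Q - Q *m (J + B *m D1 *m B ^t*) *m Q.
have hT : T ^t* = - T.
  have hK : (J + B *m D1 *m B ^t*) ^t* = - (J + B *m D1 *m B ^t*).
    by rewrite adjD hJ !adjM trmxCK hD1 mulNmx mulmxN mulmxA opprD.
  rewrite /T adjB adjZ !adjM hQ hK ha mulNmx mulmxN mulmxA scaleNr opprB opprK.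
  by rewrite addrC.
have QN : Q *m (M - B *m (D1 - D2) *m G) = T + Q *m S *m Q.
  have -> : M - B *m (D1 - D2) *m G = a%:M - (J + B *m D1 *m B ^t*) *m Q + S *m Q.
    rewrite /M /S /G !mulmxBr !mulmxBl !mulmxDl !mulmxA.
    by rewrite !opprB !opprD; apply/matrixP => i j; rewrite !mxE; ring.
  by rewrite mulmxDr mulmxBr mul_mx_scalar !mulmxA.
apply: (cost_le_frob2 (x := x) (l := x ^t* *m Q)) => //.
  by rewrite -mulmxA QN left_kernel // -QN -mulmxA Nx mulmx0.
by rewrite !adjM trmxCK hQ mulmxA.
Qed.

(** Prescribing D2 leaves D1 = E + D2, where E is the matrix of squared norm
    cost u v described at the top.  It is skew-Hermitian because the real part of
    u^* v = x^* Q M x is x^* Q R Q x. *)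
Lemma attaining_perturbation n r (J R Q : 'M[C]_n) (B : 'M[C]_(n, r)) (a : C)
    (x : 'cV[C]_n) (v : 'cV[C]_r) :
    let M := a%:M - (J - R) *m Q in
    let u := B ^t* *m Q *m x in
    let D2 := - ((x ^t* *m Q *m R *m Q *m x) 0 0 / frob2 u ^+ 2) *: (u *m u ^t*) in
    a^* = - a -> J ^t* = - J -> R ^t* = R -> Q ^t* = Q ->
    M *m x = B *m v -> u != 0 ->
  exists D1 : 'M[C]_r,
    [/\ D1 ^t* = - D1, (M - B *m (D1 - D2) *m (B ^t* *m Q)) *m x = 0 &
        frob2 (D1 - D2) = cost u v].
Proof.
move=> M u D2 ha hJ hR hQ Mx u0.
set f := frob2 u; have f0 : f != 0 by rewrite frob2_eq0.
have rf : f^* = f by apply/CrealP/ger0_real/frob2_ge0.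
set rho := (x ^t* *m Q *m R *m Q *m x) 0 0.
set s := (u ^t* *m v) 0 0.
have us : u ^t* *m v = s%:M by exact: mx11_scalar.
have su : v ^t* *m u = (s^*)%:M by rewrite -adj_scalar -us adjM trmxCK.
have uu : u ^t* *m u = f%:M by exact: mulmx_adjl.
have xR : x ^t* *m Q *m R *m Q *m x = rho%:M by exact: mx11_scalar.
have srho : s + s^* = rho + rho.
  have es : x ^t* *m Q *m M *m x = s%:M.
    by rewrite -us /u -!mulmxA Mx !adjM trmxCK hQ -!mulmxA.
  have es' : x ^t* *m M ^t* *m Q *m x = (s^*)%:M.
    by rewrite -adj_scalar -es !adjM trmxCK hQ !mulmxA.
  have QM : Q *m M = a *: Q - Q *m J *m Q + Q *m R *m Q.
    by rewrite mulmxBr mul_mx_scalar mulmxBl mulmxBr opprB addrA addrAC !mulmxA.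
  have MQ : M ^t* *m Q = - (a *: Q - Q *m J *m Q) + Q *m R *m Q.
    transitivity ((Q *m M) ^t*); first by rewrite adjM hQ.
    rewrite QM adjD adjB adjZ !adjM hQ hJ hR ha scaleNr mulNmx mulmxN opprK.
    by rewrite opprB addrC !mulmxA addrC [X in X + _]addrC.
  have e : Q *m M + M ^t* *m Q = Q *m R *m Q + Q *m R *m Q.
    by rewrite QM MQ addrACA subrr add0r.
  have : x ^t* *m (Q *m M + M ^t* *m Q) *m x = (s + s^*)%:M.
    by rewrite mulmxDr mulmxDl !mulmxA es es' raddfD.
  rewrite e mulmxDr mulmxDl !mulmxA xR -raddfD => /(congr1 (fun A : 'M[C]_1 => A 0 0)).
  by rewrite !mxE eqxx !mulr1n.
(* From now on u is only a vector, which keeps its definition out of the way of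
   reassociations. *)
have hu : B ^t* *m Q *m x = u by [].
clearbody u.
set E := f^-1 *: (v *m u ^t* - u *m v ^t*) + (s^* / f ^+ 2) *: (u *m u ^t*).
have EJ : E ^t* = f^-1 *: (u *m v ^t* - v *m u ^t*) + (s / f ^+ 2) *: (u *m u ^t*).
  have c1 : (f^-1)^* = f^-1 by rewrite fmorphV /= rf.
  have c2 : (s^* / f ^+ 2)^* = s / f ^+ 2.
    by rewrite fmorph_div /= conjCK rmorphXn /= rf.
  by rewrite adjD !adjZ adjB !adjM !trmxCK c1 c2.
have Eu : E *m u = v.
  rewrite mulmxDl -!scalemxAl mulmxBl -!mulmxA uu su !mul_mx_scalar scalerBr.
  rewrite !scalerA mulVf // scale1r -addrA -scaleNr -scalerDl.
  have -> : - (f^-1 * s^*) + s^* / f ^+ 2 * f = 0 by field.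
  by rewrite scale0r addr0.
exists (E + D2); split.
- have rrho : rho^* = rho.
    have : (rho^*)%:M = rho%:M :> 'M[C]_1.
      by rewrite -adj_scalar -xR !adjM trmxCK hR hQ !mulmxA.
    by move=> /(congr1 (fun A : 'M[C]_1 => A 0 0)); rewrite !mxE eqxx !mulr1n.
  have c3 : (- (rho / f ^+ 2))^* = - (rho / f ^+ 2).
    by rewrite rmorphN fmorph_div rmorphXn /= rf rrho.
  rewrite adjD EJ adjZ adjM trmxCK c3.
  rewrite /E /D2 -/rho -/f; apply/matrixP => i j; rewrite !mxE.
  have es : s = rho + rho - s^* by rewrite -srho addrK.
  move: (s^*) es => t ->.
  set b := \sum_(_ < _) _; set c := \sum_(_ < _) _; set d := \sum_(_ < _) _.
  by field.
- by rewrite addrK mulmxBl -(mulmxA _ _ x) hu -(mulmxA B) Eu Mx subrr.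
- rewrite addrK /frob2 {1}/E mulmxDl -!scalemxAl mulmxBl -!mulmxA.
  have -> : u ^t* *m E ^t* = v ^t* by rewrite -adjM Eu.
  have EJu : E ^t* *m u = (s^* / f) *: u - v + (s / f) *: u.
    rewrite EJ mulmxDl -!scalemxAl mulmxBl -!mulmxA uu su !mul_mx_scalar.
    rewrite scalerBr !scalerA mulVf // scale1r; congr (_ *: _ - _ + _ *: _).
      by rewrite mulrC.
    by field.
  have vEJu : v ^t* *m E ^t* *m u
      = (s^* / f * s^* - frob2 v + s / f * s^*)%:M.
    rewrite -mulmxA EJu mulmxDr mulmxBr -!scalemxAr su mulmx_adjl.
    by rewrite !scale_scalar_mx -raddfB -raddfD.
  rewrite mxtraceD !mxtraceZ raddfB /= -/(frob2 v) (mxtrace_mulC u) vEJu.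
  rewrite (mxtrace_mulC u) su !mxtrace_scalar !mulr1n /cost us frob2_scalar1.
  by rewrite normCK -/f; field.
Qed.

Lemma frob2_eigen m n (Z : 'M[C]_(m, n)) a :
  eigenvalue (Z ^t* *m Z) a ->
  exists2 z : 'cV[C]_n, z != 0 & frob2 (Z *m z) = a * frob2 z.
Proof.
move=> /eigenvalueP[v vZ v0]; exists (v ^t*).
  by rewrite -frob2_eq0 frob2_adj frob2_eq0.
rewrite frob2_adj /frob2 adjM trmxCK mxtrace_mulC mulmxA -(mulmxA v) vZ.
by rewrite -scalemxAl mxtraceZ.
Qed.

(** In an orthonormal eigenbasis of Z^* Z, |Z z|^2 is the sum of the eigenvalues
    weighted by the squared moduli of the coordinates of z. *)
Lemma rayleigh m n (Z : 'M[C]_(m, n)) (t : C) (z : 'cV[C]_n) :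
    (forall a, eigenvalue (Z ^t* *m Z) a -> t <= a) ->
  t * frob2 z <= frob2 (Z *m z).
Proof.
move=> tmin; set A := Z ^t* *m Z.
have hA : A ^t* = A by rewrite /A adjM trmxCK.
have nA : A \is normalmx by apply/normalmxP; rewrite hA.
have AE := orthomx_spectralP nA.
have Pu := spectral_unitarymx A.
set P := spectralmx A in AE Pu; set d := spectral_diag A in AE.
have uP : P \in unitmx by exact: unitarymx_unit.
have PP : P ^t* *m P = 1%:M by rewrite -invmx_unitary // mulVmx.
have PA : P *m A = diag_mx d *m P by rewrite {1}AE !mulmxA mulmxV // mul1mx.
have td i : t <= d 0 i.
  apply: tmin; apply/eigenvalueP; exists (row i P).
    by rewrite -row_mul PA mul_diag_mx; apply/rowP => j; rewrite !mxE.
  apply/eqP => P0; have := row_mul i P (invmx P).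
  rewrite P0 mul0mx mulmxV // => /rowP/(_ i); rewrite !mxE eqxx => /eqP.
  by rewrite oner_eq0.
have nP (y : 'cV[C]_n) : frob2 (P *m y) = frob2 y.
  by rewrite /frob2 adjM mxtrace_mulC -mulmxA (mulmxA _ P) PP mul1mx mxtrace_mulC.
have -> : frob2 (Z *m z) = \sum_i d 0 i * `|(P *m z) i 0| ^+ 2.
  transitivity (\tr (diag_mx d *m (P *m z *m (P *m z) ^t*))).
    rewrite /frob2 (adjM Z) mxtrace_mulC -(mulmxA _ (Z ^t*)) (mulmxA (Z ^t*)) -/A AE.
    rewrite invmx_unitary // -!mulmxA (mulmxA _ (P ^t*)) -(adjM P).
    by rewrite mxtrace_mulC !mulmxA.
  by apply: eq_bigr => i _; rewrite mul_diag_mx !mxE big_ord1 !mxE normCK.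
rewrite -nP frob2E mulr_sumr; apply: ler_sum => i _.
by rewrite big_ord1 ler_wpM2r ?exprn_ge0.
Qed.

(** The Cholesky factor turns |B^* Q x| into the Euclidean norm of the coordinates
    W^* y of x = U y. *)
Lemma cholesky_frob2 n r k (Q : 'M[C]_n) (B : 'M[C]_(n, r)) (U : 'M[C]_(n, k))
    (W : 'M[C]_k) (y : 'cV[C]_k) :
    Q ^t* = Q -> U ^t* *m Q *m B *m B ^t* *m Q *m U = W *m W ^t* ->
  frob2 (B ^t* *m Q *m (U *m y)) = frob2 (W ^t* *m y).
Proof.
move=> hQ UW; rewrite /frob2 mxtrace_mulC [RHS]mxtrace_mulC; congr (\tr _).
transitivity (y ^t* *m (U ^t* *m Q *m B *m B ^t* *m Q *m U) *m y).
  by rewrite !adjM trmxCK hQ !mulmxA.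
by rewrite UW adjM trmxCK !mulmxA.
Qed.

Lemma trig_unitmx k (W : 'M[C]_k) :
  is_trig_mx W -> (forall i, 0 < W i i) -> W \in unitmx.
Proof.
move=> tW W0; rewrite unitmxE unitfE det_trig //.
by apply/prodf_neq0 => i _; rewrite gt_eqF.
Qed.

Lemma adj_unitmx k (W : 'M[C]_k) : W \in unitmx -> W ^t* \in unitmx.
Proof. by rewrite map_unitmx unitmx_tr. Qed.

Lemma mulmx_cV_inj m k (A A' : 'M[C]_(m, k)) :
  (forall y : 'cV[C]_k, A *m y = A' *m y) -> A = A'.
Proof.
move=> AA; apply/matrixP => i j; have /matrixP/(_ i 0) := AA (delta_mx j 0).
by rewrite -!colE !mxE.
Qed.

(** The identity of size k factors through a space of dimension r:
    1 = U^* U = (U^* M^-1 B) V. *)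
Lemma orthonormal_le n r k (M : 'M[C]_n) (B : 'M[C]_(n, r)) (U : 'M[C]_(n, k))
    (V : 'M[C]_(r, k)) :
  M \in unitmx -> U ^t* *m U = 1%:M -> M *m U = B *m V -> (k <= r)%N.
Proof.
move=> uM UU MU; have <- : \rank (1%:M : 'M[C]_k) = k by exact: mxrank1.
rewrite -UU -[in X in _ *m X](mulKmx uM U) MU !mulmxA; exact: mulmx_max_rank.
Qed.

End Perturbations.

(** * Norms over K[i] *)

Local Open Scope classical_set_scope.
Local Open Scope complex_scope.

Section Norms.
Variable K : realType.

Lemma normc_norm (z : K[i]) : (normc z)%:C = `|z|. Proof. by []. Qed.

Lemma fnorm_frob2 m n (A : 'M[K[i]]_(m, n)) : (fnorm A ^+ 2)%:C = frob2 A.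
Proof.
rewrite /fnorm sqr_sqrtr; last by do 2![apply: sumr_ge0 => ? _]; exact: sqr_ge0.
rewrite frob2E rmorph_sum; apply: eq_bigr => i _; rewrite rmorph_sum.
by apply: eq_bigr => j _; rewrite rmorphXn /= normc_norm.
Qed.

Lemma l2norm_frob2 n (x : 'cV[K[i]]_n) : (l2norm x ^+ 2)%:C = frob2 x.
Proof.
rewrite -fnorm_frob2 /fnorm /l2norm; congr ((Num.sqrt _ ^+ 2)%:C).
by apply: eq_bigr => i _; rewrite big_ord1.
Qed.

Lemma l2norm_pow4 n (x : 'cV[K[i]]_n) : (l2norm x ^+ 4)%:C = frob2 x ^+ 2.
Proof. by rewrite -l2norm_frob2 -[RHS]rmorphXn /= -exprM. Qed.

Lemma normc_sqr (z : K[i]) : (normc z ^+ 2)%:C = `|z| ^+ 2.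
Proof. by rewrite rmorphXn. Qed.

(** If the squared infimum were below L, some value of f would have its square
    below L; when A is empty the infimum and its square are +oo. *)
Lemma le_ereal_inf_sqr (T : Type) (A : set T) (f : T -> K) (L : \bar K) :
    (forall t, A t -> 0 <= f t) -> (forall t, A t -> (L <= (f t ^+ 2)%:E)%E) ->
  (L <= ereal_inf [set (f t)%:E | t in A] ^+ 2)%E.
Proof.
move=> f0 Lf.
have : (0 <= ereal_inf [set (f t)%:E | t in A])%E.
  by apply: le_ereal_inf_tmp => _ [t At <-]; rewrite lee_fin f0.
case E : (ereal_inf _) => [e| |] //; last by rewrite expe2 ?mulyy ?leey.
rewrite lee_fin => e0; rewrite -EFin_expe leNgt; apply/negP => Le.
have [r er rL] : exists2 r, e < r & (forall s, 0 <= s -> s < r -> ((s ^+ 2)%:E < L)%E).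
  case: L Lf Le => [l| |] // Lf Le; last first.
    by exists (e + 1) => [|s _ _]; rewrite ?ltrDl ?ltry.
  rewrite lte_fin in Le; have l0 : 0 < l by rewrite (le_lt_trans (sqr_ge0 e)).
  exists (Num.sqrt l); first by rewrite -[e]ger0_norm // -sqrtr_sqr ltr_sqrt.
  move=> s s0 sl; rewrite lte_fin -[l]sqr_sqrtr ?ltW //.
  by rewrite ltr_pXn2r ?nnegrE ?sqrtr_ge0.
have := @ereal_inf_lt _ [set (f t)%:E | t in A] r%:E.
rewrite E lte_fin => /(_ er)[_ [t At <-]]; rewrite lte_fin => ftr.
by have := rL _ (f0 _ At) ftr; rewrite ltNge Lf.
Qed.

End Norms.

(** * Smallest singular value *)

Section SingularValues.
Variable K : realType.

(** When n <= m the Gram matrix of order n, whose eigenvalues are nonnegative, is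
    the one that defines the singular values. *)
Lemma eigenvalue_singular m n (Z : 'M[K[i]]_(m, n)) a : (n <= m)%N ->
  eigenvalue (Z ^t* *m Z) a -> exists2 t, singular_value Z t & a = (t ^+ 2)%:C.
Proof.
move=> nm Za; have [z z0 fz] := frob2_eigen Za.
have a0 : 0 <= a.
  by rewrite -(pmulr_lge0 _ (_ : 0 < frob2 z)) ?frob2_gt0 // -fz frob2_ge0.
have /complex_realP[b ab] : a \is Num.real by exact: ger0_real.
have b0 : 0 <= b by rewrite -ler0c -ab.
exists (Num.sqrt b); last by rewrite ab sqr_sqrtr.
by split; [exact: sqrtr_ge0|rewrite nm (sqr_sqrtr b0) -ab; exact: Za].
Qed.

Lemma singular_value_lb m n (Z : 'M[K[i]]_(m, n)) :
  lbound [set s | singular_value Z s] 0.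
Proof. by move=> s []. Qed.

(** A square matrix of positive order over K[i] has an eigenvalue, so this is not
    the infimum of an empty set. *)
Lemma le_sigma_min m n (Z : 'M[K[i]]_(m, n)) e : (0 < n <= m)%N ->
  (forall t, singular_value Z t -> e <= t) -> e <= sigma_min Z.
Proof.
case/andP=> n0 nm et; apply: lb_le_inf => //.
have [a Za] := eigenvalue_closed (Z ^t* *m Z) n0.
by have [t Zt _] := eigenvalue_singular nm Za; exists t.
Qed.

Lemma sigma_min_rayleigh m n (Z : 'M[K[i]]_(m, n)) (z : 'cV_n) : (0 < n <= m)%N ->
  (sigma_min Z ^+ 2)%:C * frob2 z <= frob2 (Z *m z).
Proof.
move=> nm; apply: rayleigh => a /(eigenvalue_singular (andP nm).2)[t Zt ->].
rewrite lecR ler_pXn2r ?nnegrE //; last by case: Zt.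
  by apply: ge_inf => //; exists 0; exact: singular_value_lb.
by apply: le_sigma_min => // s [].
Qed.

Lemma singular_valueP m n (Z : 'M[K[i]]_(m, n)) t : (n <= m)%N ->
    singular_value Z t ->
  exists2 z : 'cV_n, z != 0 & frob2 (Z *m z) = (t ^+ 2)%:C * frob2 z.
Proof. by move=> nm [_]; rewrite nm => /frob2_eigen. Qed.

End SingularValues.

(** * The structured backward error *)

Section Problem.
Variables (K : realType) (n r : nat) (J R Q : 'M[K[i]]_n) (w : K).
Variable B : 'M[K[i]]_(n, r).
Hypotheses (hJ : J ^t* = - J) (hR : psdmx R) (hQ : pdmx Q).
Hypothesis hw : (J - R) *m Q - (w *i)%:M \in unitmx.
Hypothesis hB : \rank B = r.

Let M := shifted J R Q w.
Let G := B ^t* *m Q.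
Let X := mppinv B.

Lemma conj_wi : ((w *i)^*)%R = - (w *i).
Proof. by apply/eqP; rewrite eq_complex /= eqxx oppr0 eqxx. Qed.

Lemma shifted_unit : M \in unitmx.
Proof. by move: hw; rewrite -opprB -scaleN1r unitmxZ ?unitrN1. Qed.

Lemma mppinvK : X *m B = 1%:M.
Proof.
have [BXB _ _ _] := mppinvP B.
have /row_fullP[L LB] : row_full B by rewrite /row_full hB.
by move: (congr1 (mulmx L) BXB); rewrite !mulmxA LB mul1mx.
Qed.

Lemma OmegaP x : Omega J R Q B w x <-> M *m x = B *m (X *m M *m x).
Proof.
rewrite /Omega /nullspace /= mulmxBl mul1mx mulmxBl !mulmxA.
by split=> [/eqP|->]; rewrite ?subrr // subr_eq0 => /eqP.
Qed.

Lemma Omega_mul x v : M *m x = B *m v -> Omega J R Q B w x /\ X *m M *m x = v.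
Proof.
move=> Mx; have XMx : X *m M *m x = v.
  by rewrite -mulmxA Mx mulmxA mppinvK mul1mx.
by split=> //; apply/OmegaP; rewrite XMx.
Qed.

(** On Omega, x^* Q M x = x^* Q B v = (G x)^* v. *)
Lemma objective_cost x : Omega J R Q B w x ->
  (objective J R Q B w x)%:C = cost (G *m x) (X *m M *m x).
Proof.
move=> /OmegaP Mx; rewrite /objective /cost.
have -> : (G *m x) ^t* *m (X *m M *m x) = x ^t* *m Q *m M *m x.
  by rewrite -[RHS]mulmxA Mx !adjM trmxCK hQ.1 !mulmxA.
have realC (a b c d : K) :
    (2 * a / b - c / d)%:C = 2 * a%:C / b%:C - c%:C / d%:C.
  by rewrite rmorphB !rmorphM /= !fmorphV /= rmorph_nat.
rewrite realC l2norm_pow4 normc_sqr -frob2_scalar1 -mx11_scalar.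
congr (_ * _ / _ - _).
- exact: (l2norm_frob2 (X *m M *m x)).
- exact: (l2norm_frob2 (G *m x)).
Qed.

Let value (D : 'M[K[i]]_r * 'M[K[i]]_r) : K :=
  Num.sqrt (fnorm D.1 ^+ 2 + fnorm D.2 ^+ 2).

Let admissible := [set D : 'M[K[i]]_r * 'M[K[i]]_r | Sd R B D /\
   \det ((J - R) *m Q + B *m (D.1 - D.2) *m B ^t* *m Q - (w *i)%:M) = 0].

Lemma value_ge0 D : 0 <= value D. Proof. exact: sqrtr_ge0. Qed.

Lemma value_sqr D : value D ^+ 2 = fnorm D.1 ^+ 2 + fnorm D.2 ^+ 2.
Proof. by rewrite sqr_sqrtr // addr_ge0 // sqr_ge0. Qed.

Lemma perturbedE (E : 'M[K[i]]_r) :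
  (J - R) *m Q + B *m E *m B ^t* *m Q - (w *i)%:M = - (M - B *m E *m G).
Proof.
rewrite -(mulmxA _ (B ^t*)); set F := _ *m (_ *m Q).
have opprBB (V : zmodType) (x y z : V) : x + y - z = - (z - x - y).
  by rewrite !opprB addrCA addrA.
exact: opprBB.
Qed.

Lemma inf_objective_le_value D : admissible D ->
  (inf_objective J R Q B w <= (value D ^+ 2)%:E)%E.
Proof.
case: D => D1 D2 [[/= hD1 hD2 hS] hdet].
have dN : \det (M - B *m (D1 - D2) *m G) = 0.
  by apply/eqP; rewrite -det_opp_eq0 -perturbedE; apply/eqP.
have [y [v [My Gy cy]]] := cost_le_perturbation conj_wi hJ hQ.1 hD1 hS.1 hS.2
  shifted_unit dN.
have [Oy yv] := Omega_mul My.
apply: (@le_trans _ _ (objective J R Q B w y)%:E).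
  by apply: ereal_inf_lbound; exists y.
rewrite lee_fin -lecR objective_cost // yv value_sqr.
apply: le_trans cy _; rewrite (frob2_split hD1 hD2.1) -!fnorm_frob2.
by rewrite [leRHS]rmorphD.
Qed.

(** The bound is reached at x itself: Delta_R is prescribed to be the matrix whose
    admissibility is assumed, and Delta_J is supplied by [attaining_perturbation]. *)
Lemma exists_admissible x : feasible J R Q B w x ->
    psdmx (R + B *m DeltaR_hat R Q B x *m B ^t*) ->
  exists2 D, admissible D & value D ^+ 2 = objective J R Q B w x.
Proof.
case=> Ox Gx psdx; have /OmegaP Mx := Ox.
have [D1 [hD1 Nx fD]] :=
  attaining_perturbation conj_wi hJ hR.1 hQ.1 Mx Gx.
set D2 := - _ *: _ in Nx fD.
have D2E : DeltaR_hat R Q B x = D2.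
  by rewrite /DeltaR_hat /D2 l2norm_pow4.
have hD2 : nsdmx D2.
  have c0 : 0 <= (x ^t* *m Q *m R *m Q *m x) 0 0 / frob2 (G *m x) ^+ 2.
    rewrite divr_ge0 ?exprn_ge0 ?frob2_ge0 //.
    have -> : x ^t* *m Q *m R *m Q *m x = (Q *m x) ^t* *m R *m (Q *m x).
      by rewrite adjM hQ.1 !mulmxA.
    exact: hR.2.
  by split=> [|y]; [exact: adj_rank1|exact: rank1_le0].
rewrite D2E in psdx; clearbody D2.
exists (D1, D2).
  split; first by split.
  apply/eqP; rewrite perturbedE det_opp_eq0.
  apply/det0_cVP; exists x => //.
  by apply: contraNneq Gx => ->; rewrite mulmx0.
apply/complexI; rewrite objective_cost //; apply: etrans fD.
rewrite value_sqr (frob2_split hD1 hD2.1) -!fnorm_frob2.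
exact: rmorphD.
Qed.

Lemma eta_ge0 : (0 <= eta_Sd J R Q B (w *i))%E.
Proof.
by apply: le_ereal_inf_tmp => _ [D _ <-]; rewrite lee_fin sqrtr_ge0.
Qed.

Lemma inf_objective_le : (inf_objective J R Q B w <= eta_Sd J R Q B (w *i) ^+ 2)%E.
Proof.
apply: le_ereal_inf_sqr => D hD; first exact: value_ge0.
exact: inf_objective_le_value.
Qed.

Lemma eta_attained x : feasible J R Q B w x ->
    (objective J R Q B w x)%:E = inf_objective J R Q B w ->
    psdmx (R + B *m DeltaR_hat R Q B x *m B ^t*) ->
  exists e : K, [/\ 0 <= e, eta_Sd J R Q B (w *i) = e%:E &
    e ^+ 2 = objective J R Q B w x].
Proof.
move=> fx infx psdx; have [D aD vD] := exists_admissible fx psdx.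
have eD : (eta_Sd J R Q B (w *i) <= (value D)%:E)%E.
  by apply: ereal_inf_lbound; exists D.
have := inf_objective_le; have := eta_ge0; move: eD; rewrite -infx -vD.
case: (eta_Sd _ _ _ _ _) => [e| |] //.
rewrite -EFin_expe !lee_fin => eD e0 De; exists e; split=> //.
by apply/le_anti; rewrite De andbT ler_pXn2r ?nnegrE ?value_ge0.
Qed.

Section SigmaMin.
Variables (k : nat) (U : 'M[K[i]]_(n, k)) (W : 'M[K[i]]_k).
Hypothesis hU : orthonormal_basis U (Omega J R Q B w).
Hypothesis hW : is_cholesky (U ^t* *m Q *m B *m B ^t* *m Q *m U) W.

Let Z := X *m M *m U *m invmx (W ^t*).

Lemma cholesky_unit : W ^t* \in unitmx.
Proof. by case: hW => tW W0 _; apply: adj_unitmx; apply: trig_unitmx. Qed.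

Lemma Omega_basis y : Omega J R Q B w (U *m y).
Proof. by apply/hU.2; exists y. Qed.

(** This decides which Gram matrix defines the singular values of Z: it is the
    one of order k, Z^* Z. *)
Lemma basis_le : (k <= r)%N.
Proof.
apply: (orthonormal_le (V := X *m M *m U) shifted_unit hU.1).
apply: mulmx_cV_inj => y; have /OmegaP My := Omega_basis y.
by rewrite -[LHS]mulmxA My -!mulmxA.
Qed.

Lemma basis_gt0 x : feasible J R Q B w x -> (0 < k)%N.
Proof.
case=> /hU.2[y ->] Gx; rewrite lt0n; apply: contraNneq Gx => k0.
suff -> : y = 0 by rewrite !mulmx0.
by apply/matrixP => l; have := leq_trans (ltn_ord l) (eq_leq k0).
Qed.

(** With [feasible_param_inv]: the coordinates z = W^* y identify the pairs
    (G x, B^+ M x) with the pairs (z, Z z), as far as norms are concerned. *)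
Lemma feasible_param z : z != 0 ->
  exists x, [/\ feasible J R Q B w x, X *m M *m x = Z *m z &
     frob2 (G *m x) = frob2 z].
Proof.
move=> z0; have uW := cholesky_unit.
have Gz : frob2 (G *m (U *m (invmx (W ^t*) *m z))) = frob2 z.
  by rewrite (cholesky_frob2 _ hQ.1 (let: And3 _ _ e := hW in e)) mulKVmx.
exists (U *m (invmx (W ^t*) *m z)); split=> //; last by rewrite /Z !mulmxA.
by split; [exact: Omega_basis|rewrite -frob2_eq0 Gz frob2_eq0].
Qed.

Lemma feasible_param_inv x : feasible J R Q B w x ->
  exists z, X *m M *m x = Z *m z /\ frob2 (G *m x) = frob2 z.
Proof.
case=> /hU.2[y ->] _; exists (W ^t* *m y).
rewrite (cholesky_frob2 _ hQ.1 (let: And3 _ _ e := hW in e)).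
by split=> //; rewrite /Z -!mulmxA mulKmx ?cholesky_unit.
Qed.

Lemma sigma_min_le_objective x : feasible J R Q B w x ->
  sigma_min Z ^+ 2 <= objective J R Q B w x.
Proof.
move=> fx; have [Ox Gx] := fx; have [z [XMx fz]] := feasible_param_inv fx.
rewrite -lecR objective_cost //; apply: le_trans (cost_ge _ Gx).
rewrite ler_pdivlMr ?frob2_gt0 // XMx fz.
by apply: sigma_min_rayleigh; rewrite (basis_gt0 fx) basis_le.
Qed.

Lemma objective_le_singular t : singular_value Z t ->
  exists2 x, feasible J R Q B w x & objective J R Q B w x <= 2 * t ^+ 2.
Proof.
move=> /(singular_valueP basis_le)[z z0 Zz].
have [x [fx XMx fz]] := feasible_param z0; exists x => //.
rewrite -lecR (objective_cost fx.1); apply: le_trans (cost_le _ _) _.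
rewrite XMx Zz fz mulfK ?frob2_eq0 //.
by rewrite [leRHS]rmorphM /= rmorph_nat.
Qed.

End SigmaMin.

End Problem.

Theorem theorem5p4 (K : realType) (n r : nat) (J R Q : 'M[K[i]]_n) (w : K)
    (B : 'M[K[i]]_(n, r))
    (hJ : J ^t* = - J) (hR : psdmx R) (hQ : pdmx Q)
    (hw : (J - R) *m Q - (w *i)%:M \in unitmx)
    (hB : \rank B = r)
    (hOmega : Omega J R Q B w <> [set 0]) :
  (inf_objective J R Q B w <= eta_Sd J R Q B (w *i) ^+ 2)%E /\
  (forall xhat : 'cV[K[i]]_n,
     feasible J R Q B w xhat ->
     (objective J R Q B w xhat)%:E = inf_objective J R Q B w ->
     psdmx (R + B *m DeltaR_hat R Q B xhat *m B ^t*) ->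
     (eta_Sd J R Q B (w *i) ^+ 2)%E = inf_objective J R Q B w /\
     (forall (k : nat) (U : 'M[K[i]]_(n, k)) (W : 'M[K[i]]_k),
        orthonormal_basis U (Omega J R Q B w) ->
        pdmx (U ^t* *m Q *m B *m B ^t* *m Q *m U) ->
        is_cholesky (U ^t* *m Q *m B *m B ^t* *m Q *m U) W ->
        let s := sigma_min (mppinv B *m shifted J R Q w *m U *m invmx (W ^t*)) in
        ((Num.sqrt 2 * s)%:E >= eta_Sd J R Q B (w *i))%E /\
        (eta_Sd J R Q B (w *i) >= s%:E)%E)).
Proof.
split=> [|x fx infx psdx]; first exact: inf_objective_le.
have [e [e0 -> ex]] := eta_attained hJ hR hQ hw hB fx infx psdx.
split=> [|k U W hU _ hW s]; first by rewrite -EFin_expe ex.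
have k0 := basis_gt0 hU fx; have kr := basis_le hw hU.
rewrite !lee_fin; split; last first.
  have s0 : 0 <= s by apply: le_sigma_min; [rewrite k0|move=> t []].
  rewrite -(ler_pXn2r (ltn0Sn 1)) ?nnegrE // ex.
  exact: sigma_min_le_objective.
rewrite mulrC -ler_pdivrMr ?sqrtr_gt0 //; apply: le_sigma_min; first by rewrite k0.
move=> t Zt; have t0 : 0 <= t by case: Zt.
have [y fy yt] := objective_le_singular hQ hw hU hW Zt.
rewrite ler_pdivrMr ?sqrtr_gt0 // -(ler_pXn2r (ltn0Sn 1)) ?nnegrE ?mulr_ge0 ?sqrtr_ge0 //.
rewrite exprMn sqr_sqrtr // mulrC ex; apply: le_trans yt.
by rewrite -lee_fin infx; apply: ereal_inf_lbound; exists y.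
Qed.
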